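(* Let $\mathbf{A},\mathbf{B}$ be symmetric $n\times n$ real matrices. Assume that $\mathbf{B}$ is positive definite and strictly diagonally dominant, and that $\mathbf{A}$ is copositive. Let $\lambda\in\mathbb{R}$ be a complementarity eigenvalue of $(\mathbf{A},\mathbf{B})$. Then $$\lambda\in \bigcup_{\substack{i,j\in[n]\\ i\ne j}}\left[\max\left\{0,\ \min\{y\in\mathbb{R}\mid P^{\mathrm{low}}_{ij}(y)=0\}\right\},\ \max\{y\in\mathbb{R}\mid P^{\mathrm{up}}_{ij}(y)=0\}\right]=:K_2.$$
   Context: $[n]=\{1,\dots,n\}$; vector inequalities are componentwise. A real number $\lambda$ is a complementarity eigenvalue of $(\mathbf{A},\mathbf{B})$ if there is $\mathbf{x}\in\mathbb{R}^n$ with $(\mathbf{A}-\lambda\mathbf{B})\mathbf{x}\ge\mathbf{0}$, $\mathbf{x}\ge\mathbf{0}$, $\mathbf{x}^\top(\mathbf{A}-\lambda\mathbf{B})\mathbf{x}=0$ and $\sum_{i=1}^n x_i=1$. A matrix $\mathbf{M}=(m_{ij})\in\mathbb{R}^{n\times n}$ is strictly diagonally dominant if $|m_{ii}|>\sum_{j\ne i}|m_{ij}|$ for every $i\in[n]$. A symmetric matrix $\mathbf{M}$ is positive definite if $\mathbf{x}^\top\mathbf{M}\mathbf{x}>0$ for all $\mathbf{x}\in\mathbb{R}^n$ with $\mathbf{x}\neq\mathbf{0}$, and copositive if $\mathbf{x}^\top\mathbf{M}\mathbf{x}\ge 0$ for all $\mathbf{x}\in\mathbb{R}^n$ with $\mathbf{x}\ge\mathbf{0}$.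 For $\mathbf{M}\in\mathbb{R}^{n\times n}$ and $i,j\in[n]$ set $$r_i^+(\mathbf{M}):=\sum_{j\ne i}\max\{m_{ij},0\},\quad r_i^-(\mathbf{M}):=-\sum_{j\ne i}\min\{m_{ij},0\},$$ $$m_{ij}^+:=m_{ii}m_{jj}-r_i^+(\mathbf{M})r_j^+(\mathbf{M}),\quad m_{ij}^-:=m_{ii}m_{jj}-r_i^-(\mathbf{M})r_j^-(\mathbf{M}).$$ Thus $a_{ij}^\pm$, $b_{ij}^\pm$ denote these quantities for $\mathbf{A}=(a_{ij})$ and $\mathbf{B}=(b_{ij})$. Further, $$s_{ij}^+(\mathbf{A},\mathbf{B}):=a_{ii}b_{jj}+a_{jj}b_{ii}+r_i^+(\mathbf{A})r_j^-(\mathbf{B})+r_j^+(\mathbf{A})r_i^-(\mathbf{B}),$$ $$s_{ij}^-(\mathbf{A},\mathbf{B}):=a_{ii}b_{jj}+a_{jj}b_{ii}+r_i^-(\mathbf{A})r_j^+(\mathbf{B})+r_j^-(\mathbf{A})r_i^+(\mathbf{B}),$$ $$P^{\mathrm{up}}_{ij}(y):=b_{ij}^-y^2-s_{ij}^+(\mathbf{A},\mathbf{B})y+a_{ij}^+,\quad P^{\mathrm{low}}_{ij}(y):=b_{ij}^+y^2-s_{ij}^-(\mathbf{A},\mathbf{B})y+a_{ij}^-\quad (y\in\mathbb{R}).$$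
   Formalization: The formal theorem assumes n ≥ 2; for n = 1 the union over i ≠ j is empty while a_11/b_11 is still a complementarity eigenvalue (e.g. A = B = (1), λ = 1), so the claim as stated fails there. *)

(* Defs.v *)
From HB Require Import structures.
From mathcomp Require Import all_boot all_order all_algebra.
From mathcomp Require Import sesquilinear.
From mathcomp Require Import all_classical all_reals.

Set Implicit Arguments.
Unset Strict Implicit.
Unset Printing Implicit Defensive.

Import Order.TTheory GRing.Theory Num.Theory.

Local Open Scope classical_set_scope.
Local Open Scope ring_scope.

Definition nonneg_vec (R : realType) (n : nat) (x : 'cV[R]_n) : Prop :=
  forall i, 0 <= x i 0.

Definition quad_form (R : realType) (n : nat) (M : 'M[R]_n) (x : 'cV[R]_n) : R :=
  (x^T *m M *m x) 0 0.

Definition complementarity_eigenvalue (R : realType) (n : nat)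
    (A B : 'M[R]_n) (lambda : R) : Prop :=
  exists x : 'cV[R]_n,
    [/\ nonneg_vec ((A - lambda *: B) *m x),
        nonneg_vec x,
        quad_form (A - lambda *: B) x = 0
      & \sum_i x i 0 = 1].

Definition strictly_diag_dominant (R : realType) (n : nat) (M : 'M[R]_n) : Prop :=
  forall i, `|M i i| > \sum_(j | j != i) `|M i j|.

Definition positive_definite (R : realType) (n : nat) (M : 'M[R]_n) : Prop :=
  M \is symmetricmx /\ forall x : 'cV[R]_n, x != 0 -> 0 < quad_form M x.

Definition copositive (R : realType) (n : nat) (M : 'M[R]_n) : Prop :=
  M \is symmetricmx /\
  forall x : 'cV[R]_n, nonneg_vec x -> 0 <= quad_form M x.

Definition rplus (R : realType) (n : nat) (M : 'M[R]_n) (i : 'I_n) : R :=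
  \sum_(j | j != i) Num.max (M i j) 0.

Definition rminus (R : realType) (n : nat) (M : 'M[R]_n) (i : 'I_n) : R :=
  - \sum_(j | j != i) Num.min (M i j) 0.

Definition mplus (R : realType) (n : nat) (M : 'M[R]_n) (i j : 'I_n) : R :=
  M i i * M j j - rplus M i * rplus M j.

Definition mminus (R : realType) (n : nat) (M : 'M[R]_n) (i j : 'I_n) : R :=
  M i i * M j j - rminus M i * rminus M j.

Definition splus (R : realType) (n : nat) (A B : 'M[R]_n) (i j : 'I_n) : R :=
  A i i * B j j + A j j * B i i + rplus A i * rminus B j + rplus A j * rminus B i.

Definition sminus (R : realType) (n : nat) (A B : 'M[R]_n) (i j : 'I_n) : R :=
  A i i * B j j + A j j * B i i + rminus A i * rplus B j + rminus A j * rplus B i.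

Definition Pup (R : realType) (n : nat) (A B : 'M[R]_n) (i j : 'I_n) (y : R) : R :=
  mminus B i j * y ^+ 2 - splus A B i j * y + mplus A i j.

Definition Plow (R : realType) (n : nat) (A B : 'M[R]_n) (i j : 'I_n) (y : R) : R :=
  mplus B i j * y ^+ 2 - sminus A B i j * y + mminus A i j.

(* Minimum and maximum are attained bounds, given as relations: there is no
   default value when a set has no least (or greatest) element. *)
Definition is_min (R : realType) (S : set R) (m : R) : Prop :=
  S m /\ lbound S m.

Definition is_max (R : realType) (S : set R) (m : R) : Prop :=
  S m /\ ubound S m.

(* A pair (i, j) contributes points only if both the least root of Plow and the
   greatest root of Pup exist. *)
Definition K2 (R : realType) (n : nat) (A B : 'M[R]_n) : set R :=
  \bigcup_(p in [set p : 'I_n * 'I_n | p.1 != p.2])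
    [set lambda | exists lo hi : R,
      [/\ is_min [set y | Plow A B p.1 p.2 y = 0] lo,
          is_max [set y | Pup A B p.1 p.2 y = 0] hi
        & lambda \in `[Num.max 0 lo, hi]]].

(* Main.v *)
(** Let [x] be a complementarity eigenvector, [x_i] its largest entry and [x_j]
    its second largest one. Complementarity turns rows [i] and [j] into
    equations, and [lambda >= 0] since [A] is copositive; bounding the
    off-diagonal part of each row by the other selected entry and multiplying
    the two bounds gives [Pup lambda <= 0] and [Plow lambda <= 0], unless both
    diagonal terms [lambda b_kk - a_kk] have the unfavourable sign. In that
    case [a_ii / b_ii] lies on the favourable side of [lambda] and the
    polynomial is nonpositive there. *)
Require Import Defs.
From mathcomp Require Import all_boot all_order all_algebra.
From mathcomp Require Import sesquilinear.
From mathcomp Require Import all_classical all_reals.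
From mathcomp Require Import ring lra.

Import Order.TTheory GRing.Theory Num.Theory.

Local Open Scope classical_set_scope.
Local Open Scope ring_scope.

(** Completing the square, [f y <= 0] makes the discriminant nonnegative; then
    [f t = a * ((t - lo) * (t - hi))], which is nonpositive only between the two roots. *)
Lemma quadratic_root_bounds (R : realType) (f : R -> R) (a b c y : R) :
  (forall t, f t = a * t ^+ 2 - b * t + c) -> 0 < a -> f y <= 0 ->
  exists lo hi, [/\ is_min [set t | f t = 0] lo,
                    is_max [set t | f t = 0] hi, lo <= y & y <= hi].
Proof.
move=> fE a_gt0 fy.
pose s := Num.sqrt (b ^+ 2 - 4 * a * c).
have s_ge0 : 0 <= s by exact: sqrtr_ge0.
have a4 t : 4 * a * f t = (2 * a * t - b) ^+ 2 - (b ^+ 2 - 4 * a * c).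
  by rewrite fE; ring.
have sE : s ^+ 2 = b ^+ 2 - 4 * a * c.
  rewrite sqr_sqrtr // -subr_le0.
  have : 4 * a * f y <= 0 by rewrite mulr_ge0_le0 // mulr_ge0 // ltW.
  by rewrite a4; have := sqr_ge0 (2 * a * y - b); lra.
pose lo := (b - s) / (2 * a); pose hi := (b + s) / (2 * a).
have fact t : f t = a * ((t - lo) * (t - hi)).
  have a_neq0 : a != 0 by rewrite gt_eqF.
  have -> : (t - lo) * (t - hi) =
      ((2 * a * t - b) ^+ 2 - s ^+ 2) / (4 * a * a) by rewrite /lo /hi; field.
  by rewrite sE -a4; field.
have lohi : lo <= hi.
  by rewrite ler_pM2r ?invr_gt0 ?mulr_gt0 //; lra.
have between t : f t <= 0 -> lo <= t /\ t <= hi.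
  rewrite fact pmulr_rle0 // => h.
  split; rewrite leNgt; apply/negP => ht.
    suff : 0 < (t - lo) * (t - hi) by rewrite ltNge h.
    by rewrite nmulr_rgt0; lra.
  suff : 0 < (t - lo) * (t - hi) by rewrite ltNge h.
  by rewrite pmulr_rgt0; lra.
have [ylo yhi] := between y fy.
exists lo, hi; split=> //; split.
- by rewrite /= fact subrr mul0r mulr0.
- by move=> t /= t0; have [] := between t; rewrite ?t0.
- by rewrite /= fact subrr !mulr0.
- by move=> t /= t0; have [] := between t; rewrite ?t0.
Qed.

(** For [u1, u2 >= 0] the two bounds are multiplied and [x1 * x2] cancelled; for mixed signs the
    product is nonpositive. The second bound is conditional because row [j] yields an equation only
    when [x_j > 0]. *)
Lemma mul_le_or_neg (R : realType) (u1 u2 s1 s2 x1 x2 : R) :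
  0 <= s1 -> 0 <= s2 -> 0 < x1 -> 0 <= x2 ->
  u1 * x1 <= s1 * x2 -> (0 < x2 -> u2 * x2 <= s2 * x1) ->
  u1 * u2 <= s1 * s2 \/ (u1 < 0 /\ u2 < 0).
Proof.
move=> s1_ge0 s2_ge0 x1_gt0 x2_ge0 h1 h2.
have s_ge0 : 0 <= s1 * s2 by exact: mulr_ge0.
case: (ltP u1 0) => u1s; case: (ltP u2 0) => u2s; first by right.
- by left; apply: le_trans s_ge0; rewrite nmulr_rle0.
- by left; apply: le_trans s_ge0; rewrite mulr_ge0_le0 // ltW.
left; case: (ltrgtP 0 x2) x2_ge0 => // [x2_gt0|x20] _.
  rewrite -(ler_pM2r (mulr_gt0 x1_gt0 x2_gt0)).
  have := ler_pM (mulr_ge0 u1s (ltW x1_gt0)) (mulr_ge0 u2s (ltW x2_gt0))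
    h1 (h2 x2_gt0).
  by lra.
(* With [x2 = 0] only the first bound remains, and it forces [u1 = 0]. *)
move: h1; rewrite -x20 mulr0 pmulr_lle0 // => u1_le0.
by rewrite (_ : u1 = 0) ?mul0r //; apply/eqP; rewrite eq_le u1_le0.
Qed.

Lemma offdiag_sum_le (R : realType) (n : nat) (i : 'I_n) (c d x : 'I_n -> R)
    (y : R) :
  (forall k, 0 <= x k) -> (forall k, k != i -> x k <= y) ->
  (forall k, c k <= d k) -> (forall k, 0 <= d k) ->
  \sum_(k | k != i) c k * x k <= (\sum_(k | k != i) d k) * y.
Proof.
move=> x_ge0 x_le cd d_ge0; rewrite mulr_suml; apply: ler_sum => k ki.
by apply: le_trans (ler_wpM2r (x_ge0 k) (cd k)) _; rewrite ler_wpM2l ?x_le.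
Qed.

Lemma rminusE (R : realType) (n : nat) (M : 'M[R]_n) (i : 'I_n) :
  rminus M i = \sum_(j | j != i) Num.max (- M i j) 0.
Proof.
by rewrite /rminus -sumrN; apply: eq_bigr => j _; rewrite oppr_min oppr0.
Qed.

Lemma rplus_ge0 (R : realType) (n : nat) (M : 'M[R]_n) (i : 'I_n) :
  0 <= rplus M i.
Proof. by apply: sumr_ge0 => j _; rewrite le_max lexx orbT. Qed.

Lemma rminus_ge0 (R : realType) (n : nat) (M : 'M[R]_n) (i : 'I_n) :
  0 <= rminus M i.
Proof. by rewrite rminusE; apply: sumr_ge0 => j _; rewrite le_max lexx orbT. Qed.

Lemma rplus_lt_diag (R : realType) (n : nat) (M : 'M[R]_n) (i : 'I_n) :
  strictly_diag_dominant M -> 0 < M i i -> rplus M i < M i i.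
Proof.
move=> /(_ i) dom Mii; rewrite gtr0_norm // in dom.
apply: le_lt_trans dom; apply: ler_sum => j _.
by rewrite ge_max normr_ge0 ler_norm.
Qed.

Lemma rminus_lt_diag (R : realType) (n : nat) (M : 'M[R]_n) (i : 'I_n) :
  strictly_diag_dominant M -> 0 < M i i -> rminus M i < M i i.
Proof.
move=> /(_ i) dom Mii; rewrite gtr0_norm // in dom.
rewrite rminusE; apply: le_lt_trans dom; apply: ler_sum => j _.
by rewrite ge_max normr_ge0 -normrN ler_norm.
Qed.

Lemma quad_formE (R : realType) (n : nat) (M : 'M[R]_n) (x : 'cV[R]_n) :
  quad_form M x = \sum_i x i 0 * (M *m x) i 0.
Proof. by rewrite /quad_form -mulmxA mxE; apply: eq_bigr => i _; rewrite mxE. Qed.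

Lemma quad_form_delta (R : realType) (n : nat) (M : 'M[R]_n) (i : 'I_n) :
  quad_form M (delta_mx i 0) = M i i.
Proof. by rewrite /quad_form trmx_delta -rowE -colE !mxE. Qed.

Lemma nonneg_delta (R : realType) (n : nat) (i : 'I_n) :
  nonneg_vec (delta_mx i 0 : 'cV[R]_n).
Proof. by move=> k; rewrite mxE ler0n. Qed.

(** The vanishing form says [quad_form A x = lambda * quad_form B x], with a nonnegative left side
    and [quad_form B x > 0]. *)
Lemma complementarity_eigenvalue_ge0 (R : realType) (n : nat) (A B : 'M[R]_n)
    (lambda : R) (x : 'cV[R]_n) :
  positive_definite B -> copositive A -> nonneg_vec x -> x != 0 ->
  quad_form (A - lambda *: B) x = 0 -> 0 <= lambda.
Proof.
move=> [_ B_pd] [_ A_cop] x_ge0 x_neq0.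
have -> : quad_form (A - lambda *: B) x = quad_form A x - lambda * quad_form B x.
  rewrite !quad_formE mulr_sumr -sumrB; apply: eq_bigr => i _.
  by rewrite mulmxBl -scalemxAl mxE [in X in _ + X]mxE [in X in - X]mxE; ring.
move=> /subr0_eq h.
have := A_cop x x_ge0; have := B_pd x x_neq0; rewrite h => Bx.
by rewrite pmulr_lge0.
Qed.

(** The form is a sum of nonnegative terms [x_k (M x)_k], so each vanishes, and [x_i > 0] leaves
    [(M x)_i = 0]. *)
Lemma complementarity_row (R : realType) (n : nat) (M : 'M[R]_n)
    (x : 'cV[R]_n) (i : 'I_n) :
  nonneg_vec (M *m x) -> nonneg_vec x -> quad_form M x = 0 -> 0 < x i 0 ->
  M i i * x i 0 = - \sum_(k | k != i) M i k * x k 0.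
Proof.
move=> w_ge0 x_ge0; rewrite quad_formE => /eqP.
rewrite psumr_eq0 => [/allP/(_ i)|k _]; last exact: mulr_ge0.
rewrite mem_index_enum => /(_ isT)/implyP/(_ isT).
rewrite mulf_eq0 => /orP[/eqP->|]; first by rewrite ltxx.
by rewrite mxE (bigD1 i) //= addr_eq0 => /eqP.
Qed.

(* For n = 1 there is no pair i <> j, so K2 is empty, whereas the pair (A, B)
   still has the complementarity eigenvalue a_11 / b_11. *)
Theorem theorem2p7 (R : realType) (n : nat) (n_ge2 : (2 <= n)%N)
    (A B : 'M[R]_n) (A_sym : A \is symmetricmx) (B_sym : B \is symmetricmx)
    (B_pd : positive_definite B) (B_sdd : strictly_diag_dominant B)
    (A_cop : copositive A)
    (lambda : R) (lambda_ev : complementarity_eigenvalue A B lambda) :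
  K2 A B lambda.
Proof.
case: lambda_ev => x [w_ge0 x_ge0 xw0 x_sum].
have x_neq0 : x != 0.
  apply/eqP => x0; move: x_sum; rewrite x0 big1 => [/eqP|i _]; last by rewrite mxE.
  by rewrite eq_sym oner_eq0.
have l_ge0 : 0 <= lambda by exact: complementarity_eigenvalue_ge0 xw0.
have Bii i : 0 < B i i.
  rewrite -quad_form_delta; apply: B_pd.2.
  apply/eqP => /matrixP/(_ i 0)/eqP; rewrite !mxE !eqxx /=.
  by rewrite oner_eq0.
have Aii i : 0 <= A i i.
  by rewrite -quad_form_delta; apply/A_cop.2/nonneg_delta.
have i0 : 'I_n by exact: Ordinal n_ge2.
have [i _ i_max] := @arg_maxP _ _ _ i0 xpredT (fun k => x k 0) isT.
have [j0 j0i] : exists j0, j0 != i.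
  have /card_gt0P[k] : (0 < #|predC1 i|)%N.
    by rewrite cardC1 card_ord -subn1 subn_gt0.
  by rewrite inE => ki; exists k.
have [j ji j_max] := @arg_maxP _ _ _ j0 (fun k => k != i) (fun k => x k 0) j0i.
have xi_gt0 : 0 < x i 0.
  rewrite lt_neqAle x_ge0 andbT; apply/eqP => xi0.
  move/eqP: x_neq0; apply; apply/matrixP => k l; rewrite ord1 mxE.
  by apply/eqP; rewrite eq_le x_ge0 andbT xi0; exact: i_max.
(* The coefficients [A k m - lambda * B k m] are bounded by the positive part of [A k m] plus
   [lambda] times the negative part of [B k m], as [lambda >= 0]. *)
have up k y : 0 < x k 0 -> (forall m, m != k -> x m 0 <= y) ->
    (lambda * B k k - A k k) * x k 0 <= (rplus A k + lambda * rminus B k) * y.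
  move=> xk /(offdiag_sum_le _ _ _ _ _ _ _ x_ge0) le_y.
  have := complementarity_row _ _ _ _ _ w_ge0 x_ge0 xw0 xk.
  rewrite !mxE => row_eq.
  have -> : (lambda * B k k - A k k) * x k 0 =
      \sum_(m | m != k) (A k m - lambda * B k m) * x m 0.
    rewrite -opprB mulNr row_eq opprK.
    by apply: eq_bigr => m _; rewrite !mxE.
  rewrite rminusE mulr_sumr /rplus -big_split /=; apply: le_y => // m.
    by rewrite lerD ?le_max ?lexx // -mulrN ler_wpM2l // le_max lexx.
  by rewrite addr_ge0 ?mulr_ge0 ?le_max ?lexx ?orbT.
(* Negating the row equation exchanges positive and negative parts. *)
have low k y : 0 < x k 0 -> (forall m, m != k -> x m 0 <= y) ->
    - (lambda * B k k - A k k) * x k 0 <= (rminus A k + lambda * rplus B k) * y.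
  move=> xk /(offdiag_sum_le _ _ _ _ _ _ _ x_ge0) le_y.
  have := complementarity_row _ _ _ _ _ w_ge0 x_ge0 xw0 xk.
  rewrite !mxE => row_eq.
  have -> : - (lambda * B k k - A k k) * x k 0 =
      \sum_(m | m != k) (- A k m + lambda * B k m) * x m 0.
    rewrite opprB row_eq -sumrN.
    by apply: eq_bigr => m _; rewrite !mxE; ring.
  rewrite rminusE /rplus mulr_sumr -big_split /=; apply: le_y => // m.
    by rewrite lerD ?ler_wpM2l // le_max lexx.
  by rewrite addr_ge0 ?mulr_ge0 ?le_max ?lexx ?orbT.
have S_ge0 k t : 0 <= t -> 0 <= rplus A k + t * rminus B k.
  by move=> t0; rewrite addr_ge0 ?mulr_ge0 ?rplus_ge0 ?rminus_ge0.
have T_ge0 k t : 0 <= t -> 0 <= rminus A k + t * rplus B k.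
  by move=> t0; rewrite addr_ge0 ?mulr_ge0 ?rplus_ge0 ?rminus_ge0.
have PupE t : Pup A B i j t = (t * B i i - A i i) * (t * B j j - A j j) -
    (rplus A i + t * rminus B i) * (rplus A j + t * rminus B j).
  by rewrite /Pup /mminus /splus /mplus; ring.
have PlowE t : Plow A B i j t = (t * B i i - A i i) * (t * B j j - A j j) -
    (rminus A i + t * rplus B i) * (rminus A j + t * rplus B j).
  by rewrite /Plow /mminus /sminus /mplus; ring.
have i_max' k : k != j -> x k 0 <= x i 0 by move=> _; exact: i_max.
(* At [r] the diagonal factor of index [i] vanishes, so both polynomials reduce to minus a product
   of nonnegative radii. *)
pose r := A i i / B i i.
have r_ge0 : 0 <= r by rewrite divr_ge0 // ltW.
have rE : r * B i i - A i i = 0 by rewrite divfK ?subrr // gt_eqF.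
(* Nonpositivity anywhere at or above [lambda] suffices, since the greatest root lies above such a
   point. If both diagonal factors are negative, then [lambda < r] and [r] serves. *)
have [yu [yu_ge yu_le0]] : exists y, lambda <= y /\ Pup A B i j y <= 0.
  have [h|[ui _]] := mul_le_or_neg _ _ _ _ _ _ _
    (S_ge0 i _ l_ge0) (S_ge0 j _ l_ge0) xi_gt0
    (x_ge0 j) (up i _ xi_gt0 j_max) (fun xj => up j _ xj i_max').
    by exists lambda; rewrite PupE subr_le0.
  exists r; rewrite PupE rE mul0r sub0r oppr_le0 mulr_ge0 ?S_ge0 //; split=> //.
  by rewrite /r ler_pdivlMr // -subr_le0 ltW.
(* Here the exceptional case has both factors positive, so [r < lambda]. *)
have [yl [yl_le yl_le0]] : exists y, y <= lambda /\ Plow A B i j y <= 0.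
  have [h|[ui _]] := mul_le_or_neg _ _ _ _ _ _ _
    (T_ge0 i _ l_ge0) (T_ge0 j _ l_ge0) xi_gt0
    (x_ge0 j) (low i _ xi_gt0 j_max) (fun xj => low j _ xj i_max').
    by exists lambda; rewrite PlowE subr_le0 -mulrNN.
  exists r; rewrite PlowE rE mul0r sub0r oppr_le0 mulr_ge0 ?T_ge0 //; split=> //.
  by rewrite /r ler_pdivrMr // -subr_ge0 ltW // -oppr_lt0.
(* Diagonal dominance makes both leading coefficients positive. *)
have mm : 0 < mminus B i j.
  by rewrite subr_gt0 ltr_pM ?rminus_ge0 ?rminus_lt_diag.
have mp : 0 < mplus B i j.
  by rewrite subr_gt0 ltr_pM ?rplus_ge0 ?rplus_lt_diag.
have [_ [hi [_ hi_max _ yu_hi]]] :=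
  quadratic_root_bounds _ _ _ _ _ _ (fun t => erefl (Pup A B i j t)) mm yu_le0.
have [lo [_ [lo_min _ lo_yl _]]] :=
  quadratic_root_bounds _ _ _ _ _ _ (fun t => erefl (Plow A B i j t)) mp yl_le0.
(* The chain is [lo <= yl <= lambda <= yu <= hi], together with [0 <= lambda]. *)
exists (i, j); first by rewrite /= eq_sym.
exists lo, hi; split=> //.
by rewrite in_itv /= ge_max l_ge0 (le_trans lo_yl) // (le_trans yu_ge).
Qed.
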